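(* Let $\Omega\subset\mathbb{R}^3$ be a domain. If the de Rham complex $$\mathbb{R}\hookrightarrow C^\infty(\Omega)\xrightarrow{\ \operatorname{grad}\ }C^\infty(\Omega;\mathbb{V})\xrightarrow{\ \operatorname{curl}\ }C^\infty(\Omega;\mathbb{V})\xrightarrow{\ \operatorname{div}\ }C^\infty(\Omega)\to0$$ is exact (i.e., the domain is contractible), then the elasticity complex $$\mathbb{T}'\hookrightarrow C^\infty(\Omega;\mathbb{V}\times\mathbb{K})\xrightarrow{\ (\operatorname{grad},-I)\ }C^\infty(\Omega;\mathbb{M})\xrightarrow{\ J\ }C^\infty(\Omega;\mathbb{M})\xrightarrow{\ (\operatorname{div},\operatorname{skw})^T\ }C^\infty(\Omega;\mathbb{V}\times\mathbb{K})\to0$$ is also exact.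
   Context: $\mathbb{V}=\mathbb{R}^3$; $\mathbb{M}$ is the space of real $3\times3$ matrices; $\mathbb{S},\mathbb{K}\subset\mathbb{M}$ are the subspaces of symmetric and skew-symmetric matrices; $\operatorname{sym}$ and $\operatorname{skw}$ denote symmetric and skew-symmetric parts. On vector fields, $\operatorname{grad}$ is taken row-wise ($(\operatorname{grad}u)_{ij}=\partial_ju_i$); on matrix fields, $\operatorname{curl}$ and $\operatorname{div}$ act on each row. $\mathbb{T}$ is the space of infinitesimal rigid motions $x\mapsto a+Bx$ with $a\in\mathbb{V}$, $B\in\mathbb{K}$, and $\mathbb{T}'=\{(v,\operatorname{grad}v): v\in\mathbb{T}\}$. The first map sends $(u,q)$ to $\operatorname{grad}u-q$; the last sends $F$ to $(\operatorname{div}F,\operatorname{skw}F)$. $J:C^\infty(\Omega;\mathbb{M})\to C^\infty(\Omega;\mathbb{M})$ is the linear operator with $J\tau=\operatorname{curl}\big((\operatorname{curl}\tau)^T\big)$ for $\tau$ with values in $\mathbb{S}$ and $J\tau=0$ for $\tau$ with values in $\mathbb{K}$. Equivalently, $J\tau=\operatorname{curl}\,\Xi^{-1}\operatorname{curl}\tau$, where $\Xi\mu=\mu^T-\operatorname{tr}(\mu)\delta$, $\Xi^{-1}\mu=\mu^T-\frac12\operatorname{tr}(\mu)\delta$, and $\delta$ is the identity matrix. Exactness means that the image (or the included subspace, at the first place) equals the kernel of the next map at every place, including surjectivity of the last differential operator. *)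

(* Defs.v *)
From HB Require Import structures.
From mathcomp Require Import all_boot all_order all_algebra.
From mathcomp Require Import all_classical all_reals all_analysis.

Set Implicit Arguments.
Unset Strict Implicit.
Unset Printing Implicit Defensive.

Import Order.TTheory GRing.Theory Num.Theory.
Import numFieldNormedType.Exports.
Local Open Scope classical_set_scope.
Local Open Scope ring_scope.

(* A field on Omega is represented by a total function on R^3, whose values
   outside Omega are irrelevant: every condition below is imposed at the
   points of Omega only, and two fields are identified when they agree on
   Omega.  As Omega is open, derivatives at its points do not depend on the
   values taken outside. *)

Definition is_domain (R : realType) (Omega : set 'cV[R]_3) : Prop :=
  [/\ open Omega, connected Omega & Omega !=set0].

Section Operators.
Variable R : realType.
Notation V := 'cV[R]_3.
Notation M := 'M[R]_3.

Definition partial (j : 'I_3) (f : V -> R) : V -> R :=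
  fun x => 'D_(delta_mx j 0) f x.

Definition partials (s : seq 'I_3) (f : V -> R) : V -> R := foldr partial f s.

Definition grad (f : V -> R) : V -> V := fun x => \col_j partial j f x.

(* Indices are added modulo 3. *)
Definition curl (v : V -> V) : V -> V := fun x =>
  \col_i (partial (i + 1) (fun y => v y (i + 2) 0) x
          - partial (i + 2) (fun y => v y (i + 1) 0) x).

Definition div (v : V -> V) : V -> R := fun x =>
  \sum_j partial j (fun y => v y j 0) x.

Definition gradV (u : V -> V) : V -> M := fun x =>
  \matrix_(i, j) partial j (fun y => u y i 0) x.

Definition curlM (F : V -> M) : V -> M := fun x =>
  \matrix_i (curl (fun y => (row i (F y))^T) x)^T.

Definition divM (F : V -> M) : V -> V := fun x =>
  \col_i div (fun y => (row i (F y))^T) x.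

Definition sym (A : M) : M := 2^-1 *: (A + A^T).

Definition skw (A : M) : M := 2^-1 *: (A - A^T).

Definition skew : set M := [set B | B^T = - B].

(* The linear operator equal to curl ((curl F)^T) on symmetric fields and to 0
   on skew-symmetric ones, by the splitting F = sym F + skw F. *)
Definition J (F : V -> M) : V -> M :=
  curlM (fun x => (curlM (fun y => sym (F y)) x)^T).

Definition rigid : set (V -> V) :=
  [set v | exists a : V, exists2 B : M, skew B & v = (fun x => a + B *m x)].

End Operators.

Section Complexes.
Variables (R : realType) (Omega : set 'cV[R]_3).
Notation V := 'cV[R]_3.
Notation M := 'M[R]_3.

Definition Cinf : set (V -> R) :=
  [set f | forall (s : seq 'I_3) (x : V), Omega x ->
    {for x, continuous (partials s f)} /\
    (forall j : 'I_3, derivable (partials s f) x (delta_mx j 0))].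

Definition Cinf_mx (m n : nat) : set (V -> 'M[R]_(m, n)) :=
  [set F | forall i j, Cinf (fun x => F x i j)].

Definition Cinf_VK : set (V -> V * M) :=
  [set p | [/\ Cinf_mx (fun x => (p x).1), Cinf_mx (fun x => (p x).2)
             & forall x, Omega x -> skew (p x).2]].

Definition im_on (X Y : Type) (A : set (V -> X)) (d : (V -> X) -> (V -> Y)) :
    set (V -> Y) :=
  [set g | exists2 f, A f & forall x, Omega x -> g x = d f x].

Definition ker_on (X : Type) (Y : zmodType) (A : set (V -> X))
    (d : (V -> X) -> (V -> Y)) : set (V -> X) :=
  [set f | A f /\ forall x, Omega x -> d f x = 0].

Definition de_rham_exact : Prop :=
  [/\ im_on [set f : V -> R | exists c : R, f = cst c] id
        = ker_on Cinf (@grad R),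
      im_on Cinf (@grad R) = ker_on (@Cinf_mx 3 1) (@curl R),
      im_on (@Cinf_mx 3 1) (@curl R) = ker_on (@Cinf_mx 3 1) (@div R)
    & im_on (@Cinf_mx 3 1) (@div R) = Cinf].

Definition elasticity_exact : Prop :=
  [/\ im_on (@rigid R) (fun v x => (v x, gradV v x))
        = ker_on Cinf_VK
            (fun p x => gradV (fun y => (p y).1) x - (p x).2),
      im_on Cinf_VK (fun p x => gradV (fun y => (p y).1) x - (p x).2)
        = ker_on (@Cinf_mx 3 3) (@J R),
      im_on (@Cinf_mx 3 3) (@J R)
        = ker_on (@Cinf_mx 3 3) (fun F x => (divM F x, skw (F x)))
    & im_on (@Cinf_mx 3 3) (fun F x => (divM F x, skw (F x))) = Cinf_VK].

End Complexes.

(* Main.v *)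
(* The elasticity complex is a BGG complex: it is assembled from two row-wise
   de Rham complexes linked by the algebraic maps cross_mx, Xi and axial.
   The two anticommutation rules curl (cross_mx w) = - Xi (grad w) and
   axial (curl F) = div (Xi F), together with J = curl Xi^-1 curl, turn each of
   the last three exactness claims into two successive applications of de Rham
   exactness.  The first one is the usual argument that the second derivatives
   of an infinitesimal rigid motion vanish.  No form of Schwarz's theorem has to
   be proved: the symmetry of second derivatives on Omega is the inclusion
   im grad <= ker curl, which is part of the hypothesis. *)
From HB Require Import structures.
Require Import Defs.
From mathcomp Require Import all_boot all_order all_algebra.
From mathcomp Require Import all_classical all_reals all_analysis.
From mathcomp Require Import ring lra.

Set Implicit Arguments.
Unset Strict Implicit.
Unset Printing Implicit Defensive.

Import Order.TTheory GRing.Theory Num.Theory.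
Import numFieldNormedType.Exports.
Local Open Scope classical_set_scope.
Local Open Scope ring_scope.

(** * Smooth scalar functions on an open set *)

Section SmoothFunctions.
Variables (R : realType) (Omega : set 'cV[R]_3).
Hypothesis openOmega : open Omega.
Notation V := 'cV[R]_3.
Implicit Types f g : V -> R.

Lemma near_eq_on f g x : Omega x -> (forall y, Omega y -> f y = g y) ->
  \forall y \near x, f y = g y.
Proof.
move=> Ox fg; have := open_nbhs_nbhs (conj openOmega Ox).
by apply: filterS => y /fg.
Qed.

Lemma eq_on_partial f g j x : (forall y, Omega y -> f y = g y) -> Omega x ->
  partial j f x = partial j g x.
Proof. by move=> fg Ox; apply: near_eq_derive; apply: near_eq_on. Qed.

Lemma eq_on_partials f g s : (forall y, Omega y -> f y = g y) ->
  forall x, Omega x -> partials s f x = partials s g x.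
Proof.
move=> fg; elim: s => [|j s IHs] x Ox /=; first exact: fg.
exact: eq_on_partial.
Qed.

(** All closure properties of [Cinf] go through this criterion: it suffices to guess the iterated
    partials up to equality on [Omega], since openness carries continuity and directional
    derivability from [F s] over to [partials s f]. *)
Lemma Cinf_on_partials f (F : seq 'I_3 -> V -> R) :
    (forall s x, Omega x -> partials s f x = F s x) ->
    (forall s x, Omega x -> {for x, continuous (F s)} /\
      forall j, derivable (F s) x (delta_mx j 0)) ->
  Cinf Omega f.
Proof.
move=> fF CF s x Ox; have [cF dF] := CF s x Ox.
have E : \forall y \near x, F s y = partials s f y.
  by apply: near_eq_on => // y /(fF s).
split=> [|j]; last exact: near_eq_derivable (dF j).
rewrite /prop_for /continuous_at fF //.
by apply: cvg_trans cF; exact: (@near_eq_cvg _ _ (nbhs x) _ _ _ E).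
Qed.

Lemma Cinf_eq_on f g : (forall x, Omega x -> f x = g x) ->
  Cinf Omega f -> Cinf Omega g.
Proof.
move=> fg Cf; apply: (@Cinf_on_partials _ (fun s => partials s f)) => // s x Ox.
by apply/esym/eq_on_partials.
Qed.

Lemma Cinf_derivable f j x : Cinf Omega f -> Omega x ->
  derivable f x (delta_mx j 0).
Proof. by move=> Cf Ox; have [_] := Cf [::] x Ox; exact. Qed.

Lemma partials_partial f j s :
  partials s (partial j f) = partials (rcons s j) f.
Proof. by rewrite /partials -cats1 foldr_cat. Qed.

Lemma Cinf_partial f j : Cinf Omega f -> Cinf Omega (partial j f).
Proof. by move=> Cf s x Ox; rewrite partials_partial; exact: Cf. Qed.

(** The last index of the sequence is the first one differentiated, so a nonempty sequence split on
    the right leaves iterated partials of some [partial j f]. *)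
Lemma Cinf_from_partial f : (forall x, Omega x -> {for x, continuous f}) ->
    (forall x j, Omega x -> derivable f x (delta_mx j 0)) ->
    (forall j, Cinf Omega (partial j f)) ->
  Cinf Omega f.
Proof.
move=> cf df Cdf; elim/last_ind => [|s j _] x Ox.
  by split=> [|j]; [exact: cf | exact: df].
by rewrite -partials_partial; exact: Cdf.
Qed.

Lemma partial_cst (c : R) j : partial j (fun _ : V => c) = (fun _ => 0).
Proof. by apply/funext => x; exact: derive_cst. Qed.

Lemma Cinf_cst (c : R) : Cinf Omega (fun _ => c).
Proof.
(* The constant is [c] for the empty sequence and 0 otherwise; only its existence matters. *)
have E s : exists d : R, partials s (fun _ : V => c) = (fun _ => d).
  elim: s => [|j s [d E]]; first by exists c.
  by exists 0; rewrite /= E partial_cst.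
move=> s x Ox; have [d ->] := E s; split=> [|j]; first exact: cst_continuous.
exact: derivable_cst.
Qed.

Lemma partialD f g j x : Cinf Omega f -> Cinf Omega g -> Omega x ->
  partial j (fun y => f y + g y) x = partial j f x + partial j g x.
Proof. by move=> Cf Cg Ox; apply: deriveD; exact: Cinf_derivable. Qed.

Lemma partialZ (c : R) f j x : Cinf Omega f -> Omega x ->
  partial j (fun y => c * f y) x = c * partial j f x.
Proof. by move=> Cf Ox; apply: (deriveZ c); exact: Cinf_derivable. Qed.

Lemma partialsD f g s : Cinf Omega f -> Cinf Omega g ->
  forall x, Omega x ->
  partials s (fun y => f y + g y) x = partials s f x + partials s g x.
Proof.
move=> Cf Cg; elim: s => [//|j s IHs] x Ox /=.
rewrite (eq_on_partial j IHs Ox); apply: deriveD.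
  by have [_] := Cf s x Ox; exact.
by have [_] := Cg s x Ox; exact.
Qed.

Lemma partialsZ (c : R) f s : Cinf Omega f -> forall x, Omega x ->
  partials s (fun y => c * f y) x = c * partials s f x.
Proof.
move=> Cf; elim: s => [//|j s IHs] x Ox /=.
rewrite (eq_on_partial j IHs Ox); apply: (deriveZ c).
by have [_] := Cf s x Ox; exact.
Qed.

Lemma CinfD f g : Cinf Omega f -> Cinf Omega g ->
  Cinf Omega (fun x => f x + g x).
Proof.
move=> Cf Cg; apply: (@Cinf_on_partials _
  (fun s x => partials s f x + partials s g x)) => s x Ox.
  exact: partialsD.
have [[cf df] [cg dg]] := (Cf s x Ox, Cg s x Ox).
split=> [|j]; first exact: continuousD.
by apply: derivableD; [exact: df | exact: dg].
Qed.

Lemma CinfZ (c : R) f : Cinf Omega f -> Cinf Omega (fun x => c * f x).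
Proof.
move=> Cf; apply: (@Cinf_on_partials _
  (fun s x => c * partials s f x)) => s x Ox; first exact: partialsZ.
have [cf df] := Cf s x Ox.
split=> [|j].
  by apply: (@continuousZ _ _ _ (fun=> c) (partials s f)) => //;
    exact: cst_continuous.
by apply: (@derivableZ _ _ _ (partials s f) c); exact: df.
Qed.

Lemma CinfN f : Cinf Omega f -> Cinf Omega (fun x => - f x).
Proof.
move=> Cf; have -> : (fun x => - f x) = (fun x => -1 * f x).
  by apply/funext => x; rewrite mulN1r.
exact: CinfZ.
Qed.

Lemma partialN f j x : Cinf Omega f -> Omega x ->
  partial j (fun y => - f y) x = - partial j f x.
Proof. by move=> Cf Ox; apply: deriveN; exact: Cinf_derivable. Qed.

Lemma derivable_coord (k : 'I_3) (x v : V) :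
  derivable (fun y : V => y k 0 : R) x v.
Proof. by have /derivable_mxP := @derivable_id R V x v; exact. Qed.

Lemma partial_coord (j k : 'I_3) :
  partial j (fun y : V => y k 0) = (fun _ => (k == j)%:R : R).
Proof.
apply/funext => x; have := derive_mx (@derivable_id R V x (delta_mx j 0)).
by rewrite derive_id => /matrixP/(_ k 0); rewrite !mxE eqxx andbT.
Qed.

Lemma Cinf_coord (k : 'I_3) : Cinf Omega (fun x => x k 0).
Proof.
apply: Cinf_from_partial => [x _|x j _|j].
- exact: coord_continuous.
- exact: derivable_coord.
- by rewrite partial_coord; exact: Cinf_cst.
Qed.

End SmoothFunctions.

(** * Entrywise calculus of matrix fields *)

Section EntrywiseDerivatives.
Variables (R : realType) (Omega : set 'cV[R]_3).
Hypothesis openOmega : open Omega.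
Notation V := 'cV[R]_3.

Lemma Cinf_mx_eq_on m n (F G : V -> 'M[R]_(m, n)) :
  (forall x, Omega x -> F x = G x) -> Cinf_mx Omega F -> Cinf_mx Omega G.
Proof.
move=> FG CF i k; apply: (Cinf_eq_on openOmega) (CF i k) => x Ox.
by rewrite FG.
Qed.

Lemma Cinf_mxD m n (F G : V -> 'M[R]_(m, n)) :
  Cinf_mx Omega F -> Cinf_mx Omega G -> Cinf_mx Omega (fun x => F x + G x).
Proof.
move=> CF CG i k; under eq_fun do rewrite mxE.
exact: CinfD (CF i k) (CG i k).
Qed.

Lemma Cinf_sum (I : Type) (r : seq I) (f : I -> V -> R) :
  (forall i, Cinf Omega (f i)) -> Cinf Omega (fun x => \sum_(i <- r) f i x).
Proof.
move=> Cf; elim: r => [|i r IHr].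
  by under eq_fun do rewrite big_nil; exact: Cinf_cst.
by under eq_fun do rewrite big_cons; exact: CinfD.
Qed.

Lemma partial_sum (I : Type) (r : seq I) (f : I -> V -> R) j x :
  (forall i, Cinf Omega (f i)) -> Omega x ->
  partial j (fun y => \sum_(i <- r) f i y) x = \sum_(i <- r) partial j (f i) x.
Proof.
move=> Cf Ox; elim: r => [|i r IHr].
  by under eq_fun do rewrite big_nil; rewrite partial_cst big_nil.
under eq_fun do rewrite big_cons.
by rewrite (partialD _ _ _ Ox) ?IHr ?big_cons//; exact: Cinf_sum.
Qed.

(** Writing each entry of [L A] as a fixed combination of the entries of [A] reduces smoothness of
    [L (F x)], and the commutation of [L] with partial derivatives, to finite sums and scalar
    multiples. *)
Lemma linear_mxE m n p q (L : 'M[R]_(m, n) -> 'M[R]_(p, q)) :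
  linear L -> forall A i k,
  L A i k = \sum_(ab : 'I_m * 'I_n) L (delta_mx ab.1 ab.2) i k * A ab.1 ab.2.
Proof.
move=> linL A i k.
pose L' : {linear 'M[R]_(m, n) -> 'M[R]_(p, q)} :=
  HB.pack L (GRing.isLinear.Build _ _ _ _ L linL).
rewrite -[L]/(L' : _ -> _) {1}(matrix_sum_delta A) pair_bigA linear_sum summxE.
by apply: eq_bigr => ab _; rewrite linearZ mxE mulrC.
Qed.

Lemma Cinf_mx_linear m n p q (L : 'M[R]_(m, n) -> 'M[R]_(p, q)) F :
  linear L -> Cinf_mx Omega F -> Cinf_mx Omega (fun x => L (F x)).
Proof.
move=> linL CF i k; under eq_fun do rewrite (linear_mxE linL).
by apply: Cinf_sum => ab; exact: CinfZ.
Qed.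

Definition partialM m n j (F : V -> 'M[R]_(m, n)) : V -> 'M[R]_(m, n) :=
  fun x => \matrix_(i, k) partial j (fun y => F y i k) x.

Lemma partialME m n j (F : V -> 'M[R]_(m, n)) x i k :
  partialM j F x i k = partial j (fun y => F y i k) x.
Proof. by rewrite mxE. Qed.

Lemma eq_on_partialM m n j (F G : V -> 'M[R]_(m, n)) x :
  (forall y, Omega y -> F y = G y) -> Omega x ->
  partialM j F x = partialM j G x.
Proof.
move=> FG Ox; apply/matrixP => i k; rewrite !mxE.
by apply: (eq_on_partial openOmega) => // y Oy; rewrite FG.
Qed.

Lemma Cinf_mx_partialM m n j (F : V -> 'M[R]_(m, n)) :
  Cinf_mx Omega F -> Cinf_mx Omega (partialM j F).
Proof.
by move=> CF i k; under eq_fun do rewrite mxE; apply: Cinf_partial.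
Qed.

Lemma partialMD m n j (F G : V -> 'M[R]_(m, n)) x :
  Cinf_mx Omega F -> Cinf_mx Omega G -> Omega x ->
  partialM j (fun y => F y + G y) x = partialM j F x + partialM j G x.
Proof.
move=> CF CG Ox; apply/matrixP => i k; rewrite !mxE.
by under eq_fun do rewrite mxE; rewrite (partialD _ (CF i k) (CG i k)).
Qed.

Lemma partialM_linear m n p q (L : 'M[R]_(m, n) -> 'M[R]_(p, q)) j F x :
  linear L -> Cinf_mx Omega F -> Omega x ->
  partialM j (fun y => L (F y)) x = L (partialM j F x).
Proof.
move=> linL CF Ox; apply/matrixP => i k; rewrite mxE.
under eq_fun do rewrite (linear_mxE linL).
rewrite partial_sum// => [|ab]; last exact: CinfZ.
rewrite (linear_mxE linL); apply: eq_bigr => ab _.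
by rewrite (partialZ _ _ (CF _ _)) ?mxE.
Qed.

End EntrywiseDerivatives.

(** * Algebra of 3 by 3 matrices and symbols of the operators *)

Section MatrixAlgebra.
Variable R : realType.
Notation V := 'cV[R]_3.
Notation M := 'M[R]_3.

(** This case analysis yields the ring constants 0, 1, 2, on which [addI3] evaluates the cyclic
    index shifts. *)
Lemma ord3P (P : 'I_3 -> Prop) : P 0 -> P 1 -> P 2 -> forall i, P i.
Proof.
move=> P0 P1 P2 [[|[|[|//]]] lti3].
- by rewrite (_ : Ordinal _ = 0) //; exact/val_inj.
- by rewrite (_ : Ordinal _ = 1) //; exact/val_inj.
- by rewrite (_ : Ordinal _ = 2) //; exact/val_inj.
Qed.

Lemma addI3 : (((1 + 1 = 2 :> 'I_3)%R * (1 + 2 = 0 :> 'I_3)%R) *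
  ((2 + 1 = 0 :> 'I_3)%R * (2 + 2 = 1 :> 'I_3)%R))%type.
Proof. by do !split; exact/val_inj. Qed.

Lemma sumI3 (F : 'I_3 -> R) : \sum_i F i = F 0 + F 1 + F 2.
Proof.
by rewrite !big_ord_recl big_ord0 addr0 addrA; congr (F _ + F _ + F _);
  exact/val_inj.
Qed.

(* cross_mx w *m y is the cross product of w and y. *)
Definition cross_mx (w : V) : M :=
  \matrix_(i, j) (w (i + 1) 0 *+ (j == i + 2) - w (i + 2) 0 *+ (j == i + 1)).

(** On [cross_mx w] this gives 2 [w]: it is twice the axial vector of the skew part, hence the
    factors [2^-1] further on. *)
Definition axial (A : M) : V := \col_i (A (i + 2) (i + 1) - A (i + 1) (i + 2)).

Definition Xi (A : M) : M := A^T - (\tr A)%:M.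

Definition Xi_inv (A : M) : M := A^T - (2^-1 * \tr A)%:M.

Lemma linear_cross_mx : linear cross_mx.
Proof. by move=> a v w; apply/matrixP => i j; rewrite !mxE; ring. Qed.

Lemma linear_axial : linear axial.
Proof. by move=> a A B; apply/matrixP => i j; rewrite !mxE; ring. Qed.

Lemma linear_half_axial : linear (fun A => 2^-1 *: axial A).
Proof. by move=> a A B; apply/matrixP => i j; rewrite !mxE; ring. Qed.

Lemma linear_Xi : linear Xi.
Proof.
move=> a A B; apply/matrixP => i j; rewrite /Xi [\tr _]linearP !mxE.
by case: (i == j) => /=; ring.
Qed.

Lemma linear_Xi_inv : linear Xi_inv.
Proof.
move=> a A B; apply/matrixP => i j; rewrite /Xi_inv [\tr _]linearP !mxE.
by case: (i == j) => /=; ring.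
Qed.

HB.instance Definition _ :=
  GRing.isLinear.Build R V M *:%R cross_mx linear_cross_mx.
HB.instance Definition _ := GRing.isLinear.Build R M V *:%R axial linear_axial.
HB.instance Definition _ := GRing.isLinear.Build R M M *:%R Xi linear_Xi.
HB.instance Definition _ :=
  GRing.isLinear.Build R M M *:%R Xi_inv linear_Xi_inv.

Lemma linear_sym : linear (@sym R).
Proof. by move=> a A B; apply/matrixP => i j; rewrite !mxE; ring. Qed.

Lemma linear_trmx m n : linear (@trmx R m n).
Proof. exact: linearP. Qed.

Lemma linear_opp m n : linear (fun A : 'M[R]_(m, n) => - A).
Proof. by move=> a A B; rewrite opprD scalerN. Qed.

(** In dimension 3, [Xi] multiplies the trace by 1 - 3 = -2, which the coefficient [2^-1] in
    [Xi_inv] compensates. *)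
Lemma XiK : cancel Xi Xi_inv.
Proof.
move=> A; have trXi : \tr (Xi A) = - 2 * \tr A.
  by rewrite linearB /= mxtrace_tr mxtrace_scalar; ring.
by apply/matrixP => i j; rewrite /Xi_inv trXi !mxE eq_sym;
  case: eqP => _ /=; lra.
Qed.

Lemma Xi_invK : cancel Xi_inv Xi.
Proof.
move=> A; have trXi : \tr (Xi_inv A) = - 2^-1 * \tr A.
  by rewrite linearB /= mxtrace_tr mxtrace_scalar; lra.
by apply/matrixP => i j; rewrite /Xi trXi !mxE eq_sym; case: eqP => _ /=; lra.
Qed.

(** This identifies skew matrices with vectors, so that conditions on skew parts become conditions
    on vector fields, to which the row-wise de Rham complexes apply. *)
Lemma skwE A : skw A = cross_mx (2^-1 *: axial A).
Proof.
apply/matrixP; elim/ord3P; elim/ord3P; rewrite !mxE !(add0r, addI3) /=; lra.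
Qed.

Lemma skw_skew (A : M) : Defs.skew A -> skw A = A.
Proof.
move=> sA; have {}sA : A^T = - A := sA.
by rewrite /skw sA opprK; apply/matrixP => i j; rewrite !mxE; lra.
Qed.

Lemma skew_cross_mx w : Defs.skew (cross_mx w).
Proof.
by apply/matrixP; elim/ord3P; elim/ord3P; rewrite !mxE !(add0r, addI3) /=; lra.
Qed.

Lemma symDskw (A : M) : sym A + skw A = A.
Proof. by apply/matrixP => i j; rewrite !mxE; lra. Qed.

(* The symbols of the differential operators: D j stands for the entrywise
   partial derivative of a field along the j-th axis. *)
Definition grad_symbol (D : 'I_3 -> V) : M := \matrix_(i, j) D j i 0.

Definition curl_symbol (D : 'I_3 -> M) : M :=
  \matrix_(i, k) (D (k + 1) i (k + 2) - D (k + 2) i (k + 1)).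

Definition div_symbol (D : 'I_3 -> M) : V := \col_i \sum_j D j i j.

Lemma curl_symbolD D E :
  curl_symbol (fun j => D j + E j) = curl_symbol D + curl_symbol E.
Proof. by apply/matrixP => i k; rewrite !mxE; ring. Qed.

Lemma curl_symbolN D : curl_symbol (fun j => - D j) = - curl_symbol D.
Proof. by apply/matrixP => i k; rewrite !mxE; ring. Qed.

Lemma div_symbolD D E :
  div_symbol (fun j => D j + E j) = div_symbol D + div_symbol E.
Proof.
apply/matrixP => i k; rewrite !mxE -big_split; apply: eq_bigr => j _.
by rewrite !mxE.
Qed.

(** At the level of symbols the anticommutation rules involve no analysis: they are linear
    identities in the entries of three arbitrary [D j], checked entry by entry. *)
Lemma curl_symbol_cross_mx D :
  curl_symbol (fun j => cross_mx (D j)) = - Xi (grad_symbol D).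
Proof.
by apply/matrixP; elim/ord3P; elim/ord3P;
  rewrite !mxE /mxtrace sumI3 !mxE !(add0r, addI3) /=; ring.
Qed.

Lemma axial_curl_symbol D :
  axial (curl_symbol D) = div_symbol (fun j => Xi (D j)).
Proof.
by apply/matrixP => i k; rewrite (ord1 k); move: i; elim/ord3P;
  rewrite !mxE sumI3 !mxE /mxtrace !sumI3 !(add0r, addI3) /=; ring.
Qed.

(** After a cyclic shift of indices, the trace of [curl_symbol D] is the sum over j of the j-th
    component of [axial (D j)], which vanishes on symmetric matrices. *)
Lemma tr_curl_symbol_sym D : \tr (curl_symbol (fun j => sym (D j))) = 0.
Proof. by rewrite /mxtrace sumI3 !mxE !(add0r, addI3) /=; ring. Qed.

End MatrixAlgebra.

(** * Differential operators on matrix fields and the anticommutation rules *)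

Section Operators.
Variables (R : realType) (Omega : set 'cV[R]_3).
Hypothesis openOmega : open Omega.
Notation V := 'cV[R]_3.
Notation M := 'M[R]_3.
Implicit Types (F G : V -> M) (u w : V -> V) (x : V).

(** Factoring each operator through its symbol lets constant linear maps, which commute with
    [partialM], be moved past it. *)
Lemma gradVE u x : gradV u x = grad_symbol (fun j => partialM j u x).
Proof. by apply/matrixP => i j; rewrite !mxE. Qed.

Lemma row_entry F i k :
  (fun y => (row i (F y))^T k 0) = (fun y => F y i k).
Proof. by apply/funext => y; rewrite 2!mxE. Qed.

Lemma curlME F x : curlM F x = curl_symbol (fun j => partialM j F x).
Proof.
apply/matrixP => i k; rewrite 3![LHS]mxE [RHS]mxE !partialME.
by rewrite !row_entry.
Qed.

Lemma divME F x : divM F x = div_symbol (fun j => partialM j F x).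
Proof.
apply/matrixP => i k; rewrite [LHS]mxE [RHS]mxE; apply: eq_bigr => j _.
by rewrite partialME row_entry.
Qed.

Lemma Cinf_mx_gradV u : Cinf_mx Omega u -> Cinf_mx Omega (gradV u).
Proof.
by move=> Cu i j; under eq_fun do rewrite mxE; exact: Cinf_partial.
Qed.

Lemma Cinf_mx_curlM F : Cinf_mx Omega F -> Cinf_mx Omega (curlM F).
Proof.
move=> CF i k; under eq_fun do rewrite curlME mxE.
by apply: CinfD => //; [|apply: CinfN => //]; exact: Cinf_mx_partialM.
Qed.

Lemma Cinf_mx_divM F : Cinf_mx Omega F -> Cinf_mx Omega (divM F).
Proof.
move=> CF i k; under eq_fun do rewrite divME mxE.
by apply: Cinf_sum => // j; exact: Cinf_mx_partialM.
Qed.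

Lemma eq_on_gradV u w x : (forall y, Omega y -> u y = w y) -> Omega x ->
  gradV u x = gradV w x.
Proof.
move=> uw Ox; rewrite !gradVE; congr grad_symbol; apply/funext => j.
exact: eq_on_partialM uw Ox.
Qed.

Lemma eq_on_curlM F G x : (forall y, Omega y -> F y = G y) -> Omega x ->
  curlM F x = curlM G x.
Proof.
move=> FG Ox; rewrite !curlME; congr curl_symbol; apply/funext => j.
exact: eq_on_partialM FG Ox.
Qed.

Lemma eq_on_divM F G x : (forall y, Omega y -> F y = G y) -> Omega x ->
  divM F x = divM G x.
Proof.
move=> FG Ox; rewrite !divME; congr div_symbol; apply/funext => j.
exact: eq_on_partialM FG Ox.
Qed.

Lemma curlMD F G x : Cinf_mx Omega F -> Cinf_mx Omega G -> Omega x ->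
  curlM (fun y => F y + G y) x = curlM F x + curlM G x.
Proof.
move=> CF CG Ox; rewrite !curlME -curl_symbolD; congr curl_symbol.
by apply/funext => j; exact: partialMD CF CG Ox.
Qed.

Lemma curlMN F x : Cinf_mx Omega F -> Omega x ->
  curlM (fun y => - F y) x = - curlM F x.
Proof.
move=> CF Ox; rewrite !curlME -curl_symbolN; congr curl_symbol.
by apply/funext => j; exact: partialM_linear (@linear_opp _ _ _) CF Ox.
Qed.

Lemma divMD F G x : Cinf_mx Omega F -> Cinf_mx Omega G -> Omega x ->
  divM (fun y => F y + G y) x = divM F x + divM G x.
Proof.
move=> CF CG Ox; rewrite !divME -div_symbolD; congr div_symbol.
by apply/funext => j; exact: partialMD CF CG Ox.
Qed.

Lemma curlM_cross_mx w x : Cinf_mx Omega w -> Omega x ->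
  curlM (fun y => cross_mx (w y)) x = - Xi (gradV w x).
Proof.
move=> Cw Ox; rewrite curlME gradVE -curl_symbol_cross_mx; congr curl_symbol.
by apply/funext => j; exact: partialM_linear (@linear_cross_mx _) Cw Ox.
Qed.

Lemma axial_curlM F x : Cinf_mx Omega F -> Omega x ->
  axial (curlM F x) = divM (fun y => Xi (F y)) x.
Proof.
move=> CF Ox; rewrite curlME divME axial_curl_symbol; congr div_symbol.
apply/funext => j.
by rewrite (partialM_linear openOmega _ (@linear_Xi _) CF Ox).
Qed.

Lemma tr_curlM_sym F x : Cinf_mx Omega F -> Omega x ->
  \tr (curlM (fun y => sym (F y)) x) = 0.
Proof.
move=> CF Ox.
rewrite curlME -[RHS](tr_curl_symbol_sym (fun j => partialM j F x)).
congr (\tr (curl_symbol _)).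
by apply/funext => j; exact: partialM_linear (@linear_sym _) CF Ox.
Qed.

End Operators.

(** * Consequences of de Rham exactness, row by row *)

Section DeRham.
Variables (R : realType) (Omega : set 'cV[R]_3).
Hypotheses (openOmega : open Omega) (deRham : de_rham_exact Omega).
Notation V := 'cV[R]_3.
Notation M := 'M[R]_3.
Implicit Types (F G : V -> M) (u w : V -> V) (x : V).

Lemma grad_eq0 (f : V -> R) : Cinf Omega f ->
  (forall x, Omega x -> grad f x = 0) -> exists c, forall x, Omega x -> f x = c.
Proof.
move=> Cf f0; have [+ _ _ _] := deRham; move/seteqP => [_ /(_ f)].
by case=> // _ [c ->] fc; exists c.
Qed.

Lemma curl_grad (f : V -> R) x : Cinf Omega f -> Omega x -> curl (grad f) x = 0.
Proof.
move=> Cf; have [_ + _ _] := deRham; move/seteqP => [/(_ (grad f)) + _].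
by case; [exists f | move=> _; exact].
Qed.

Lemma div_curl u x : Cinf_mx Omega u -> Omega x -> div (curl u) x = 0.
Proof.
move=> Cu; have [_ _ + _] := deRham; move/seteqP => [/(_ (curl u)) + _].
by case; [exists u | move=> _; exact].
Qed.

Lemma partialC (f : V -> R) i j x : Cinf Omega f -> Omega x ->
  partial i (partial j f) x = partial j (partial i f) x.
Proof.
move=> Cf Ox.
have E k : partial (k + 1) (partial (k + 2) f) x =
           partial (k + 2) (partial (k + 1) f) x.
  have := curl_grad Cf Ox; move/colP/(_ k); rewrite 2!mxE => /eqP.
  rewrite subr_eq0 => /eqP.
  by do 2!under [fun y => grad f y _ _]eq_fun do rewrite mxE.
(* The three components of curl grad cover the index pairs (1,2), (2,0) and (0,1). *)
have := E 0; rewrite !add0r => E0; have := E 1; rewrite !addI3 => E1.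
have := E 2; rewrite !addI3 => E2.
move: i j; elim/ord3P; elim/ord3P; [reflexivity | exact: E2 | exact: esym E1
  | exact: esym E2 | reflexivity | exact: E0
  | exact: E1 | exact: esym E0 | reflexivity].
Qed.

Lemma row_rows (g : 'I_3 -> V -> V) i :
  (fun x => (row i (\matrix_k (g k x)^T))^T) = g i.
Proof. by apply/funext => x; rewrite rowK trmxK. Qed.

Lemma row_gradV i u :
  (fun x => (row i (gradV u x))^T) = grad (fun x => u x i 0).
Proof. by apply/funext => x; apply/colP => j; rewrite !mxE. Qed.

Lemma row_curlM i F :
  (fun x => (row i (curlM F x))^T) = curl (fun x => (row i (F x))^T).
Proof. by apply/funext => x; rewrite rowK trmxK. Qed.

Lemma Cinf_mx_row i F : Cinf_mx Omega F ->
  Cinf_mx Omega (fun x => (row i (F x))^T).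
Proof. by move=> CF j k; under eq_fun do rewrite mxE mxE; exact: CF. Qed.

Lemma curlM_gradV u x : Cinf_mx Omega u -> Omega x -> curlM (gradV u) x = 0.
Proof.
move=> Cu Ox; apply/matrixP => i k; rewrite 2!mxE row_gradV curl_grad //.
by rewrite 2!mxE.
Qed.

Lemma divM_curlM F x : Cinf_mx Omega F -> Omega x -> divM (curlM F) x = 0.
Proof.
move=> CF Ox; apply/colP => i; rewrite mxE row_curlM div_curl ?mxE//.
exact: Cinf_mx_row.
Qed.

(** Each row of [F] is curl free and so has a scalar potential; the three potentials, gathered by
    [choice], are the components of [u]. The next two lemmas stack row-wise preimages in the same
    way. *)
Lemma curlM_eq0 F : Cinf_mx Omega F ->
    (forall x, Omega x -> curlM F x = 0) ->
  exists2 u, Cinf_mx Omega u & forall x, Omega x -> F x = gradV u x.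
Proof.
move=> CF F0; have [_ + _ _] := deRham; move/seteqP => [_ lift].
have /choice [f fP] (i : 'I_3) : exists f, Cinf Omega f /\
    forall x, Omega x -> (row i (F x))^T = grad f x.
  have [|f Cf Ef] := lift (fun x => (row i (F x))^T); last by exists f.
  split=> [|x Ox]; first exact: Cinf_mx_row.
  have /row_matrixP/(_ i) := F0 x Ox.
  by rewrite rowK row0 => /(canRL (@trmxK _ _ _)) ->; rewrite trmx0.
exists (fun x => \col_i f i x) => [i k|x Ox].
  by under eq_fun do rewrite mxE; have [] := fP i.
apply/matrixP => i j; have /colP/(_ j) := (fP i).2 x Ox.
rewrite 2!mxE => ->; rewrite 2!mxE; congr (partial _ _ _).
by apply/funext => y; rewrite mxE.
Qed.

Lemma divM_eq0 F : Cinf_mx Omega F ->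
    (forall x, Omega x -> divM F x = 0) ->
  exists2 G, Cinf_mx Omega G & forall x, Omega x -> F x = curlM G x.
Proof.
move=> CF F0; have [_ _ + _] := deRham; move/seteqP => [_ lift].
have /choice [g gP] (i : 'I_3) : exists g : V -> V, Cinf_mx Omega g /\
    forall x, Omega x -> (row i (F x))^T = curl g x.
  have [|g Cg Eg] := lift (fun x => (row i (F x))^T); last by exists g.
  split=> [|x Ox]; first exact: Cinf_mx_row.
  by have /colP/(_ i) := F0 x Ox; rewrite mxE [RHS]mxE.
exists (fun x => \matrix_i (g i x)^T) => [i k|x Ox].
  by under eq_fun do rewrite mxE mxE; have [+ _] := gP i; exact.
apply/row_matrixP => i; apply/trmx_inj; rewrite (gP i).2 //.
by rewrite rowK trmxK row_rows.
Qed.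

Lemma divM_surj u : Cinf_mx Omega u ->
  exists2 F, Cinf_mx Omega F & forall x, Omega x -> u x = divM F x.
Proof.
move=> Cu; have [_ _ _ /seteqP [_ lift]] := deRham.
have /choice [g gP] (i : 'I_3) : exists g : V -> V, Cinf_mx Omega g /\
    forall x, Omega x -> u x i 0 = div g x.
  by have [|g Cg Eg] := lift (fun x => u x i 0); [exact: Cu | exists g].
exists (fun x => \matrix_i (g i x)^T) => [i k|x Ox].
  by under eq_fun do rewrite mxE mxE; have [+ _] := gP i; exact.
apply/colP => i; by rewrite (gP i).2 // [RHS]mxE row_rows.
Qed.

(** The inner curl is - Xi (grad w), so [Xi_inv] leaves - grad w, which the outer curl kills. *)
Lemma curlM_Xi_inv_curlM_cross_mx w x : Cinf_mx Omega w -> Omega x ->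
  curlM (fun y => Xi_inv (curlM (fun z => cross_mx (w z)) y)) x = 0.
Proof.
move=> Cw Ox; have Cgw := Cinf_mx_gradV Cw.
rewrite (eq_on_curlM openOmega (G := fun y => - gradV w y)) => [|y Oy|//].
  by rewrite (curlMN openOmega Cgw Ox) curlM_gradV ?oppr0.
by rewrite (curlM_cross_mx openOmega Cw Oy) linearN /= XiK.
Qed.

(* The symmetric part of F contributes curl ((curl (sym F))^T) because
   curl (sym F) is traceless, the skew part contributes nothing. *)
Lemma JE F x : Cinf_mx Omega F -> Omega x ->
  J F x = curlM (fun y => Xi_inv (curlM F y)) x.
Proof.
move=> CF Ox; pose w y := 2^-1 *: axial (F y).
pose S y := sym (F y); pose K y := cross_mx (w y).
have Cw : Cinf_mx Omega w by exact: Cinf_mx_linear (@linear_half_axial R) CF.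
have CS : Cinf_mx Omega S by exact: Cinf_mx_linear (@linear_sym R) CF.
have CK : Cinf_mx Omega K by exact: Cinf_mx_linear (@linear_cross_mx R) Cw.
have CXK : Cinf_mx Omega (fun y => Xi_inv (curlM K y)).
  exact: Cinf_mx_linear (@linear_Xi_inv R) (Cinf_mx_curlM openOmega CK).
have CtS : Cinf_mx Omega (fun y => (curlM S y)^T).
  exact: Cinf_mx_linear (@linear_trmx R _ _) (Cinf_mx_curlM openOmega CS).
have FE : F = (fun y => S y + K y).
  by apply/funext => y; rewrite /S /K -skwE symDskw.
rewrite (eq_on_curlM openOmega (F := fun y => Xi_inv (curlM F y))
  (G := fun y => (curlM S y)^T + Xi_inv (curlM K y)) _ Ox) => [|y Oy].
  by rewrite (curlMD CtS CXK Ox) curlM_Xi_inv_curlM_cross_mx ?addr0.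
rewrite {1}FE (curlMD CS CK Oy) linearD /=; congr (_ + _).
by rewrite /Xi_inv (tr_curlM_sym openOmega CF Oy) mulr0 raddf0 subr0.
Qed.

End DeRham.

(** * Exactness of the elasticity complex at its four places *)

Section Exactness.
Variables (R : realType) (Omega : set 'cV[R]_3).
Hypotheses (domOmega : is_domain Omega) (deRham : de_rham_exact Omega).
Notation V := 'cV[R]_3.
Notation M := 'M[R]_3.

Let openOmega : open Omega. Proof. by case: domOmega. Qed.

Lemma partialM_id j (x : V) : partialM j id x = delta_mx j 0.
Proof.
apply/matrixP => i k; rewrite (ord1 k) partialME partial_coord.
by rewrite mxE eqxx andbT.
Qed.

Lemma linear_mulmx (B : M) : linear (mulmx B : V -> V).
Proof. exact: linearP. Qed.

Lemma Cinf_mx_affine (a : V) (B : M) : Cinf_mx Omega (fun x => a + B *m x).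
Proof.
apply: (@Cinf_mxD _ _ openOmega _ _ (cst a)) => [i k|]; first exact: Cinf_cst.
apply: (Cinf_mx_linear openOmega (linear_mulmx B)) => i k.
by rewrite (ord1 k); exact: Cinf_coord.
Qed.

Lemma gradV_affine (a : V) (B : M) x : Omega x ->
  gradV (fun y => a + B *m y) x = B.
Proof.
move=> Ox; have Ca : Cinf_mx Omega (cst a) by move=> i k; exact: Cinf_cst.
have Cid : Cinf_mx Omega id by move=> i k; rewrite (ord1 k); exact: Cinf_coord.
have CB := Cinf_mx_linear openOmega (linear_mulmx B) Cid.
rewrite gradVE; apply/matrixP => i j; rewrite mxE.
rewrite (partialMD _ Ca CB Ox).
rewrite (partialM_linear openOmega _ (linear_mulmx B) Cid Ox) partialM_id -colE.
by rewrite mxE partialME partial_cst add0r mxE.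
Qed.

Lemma Cinf_mx_half_axial (q : V -> M) : Cinf_mx Omega q ->
  Cinf_mx Omega (fun x => 2^-1 *: axial (q x)).
Proof. by move=> Cq; exact: Cinf_mx_linear (@linear_half_axial R) Cq. Qed.

(** Three sign changes around a closed chain give a = - a. This is the reason why a tensor with
    three indices, skew in the first two and symmetric in the last two, vanishes. *)
Lemma alternating_eq0 (a b c d e f : R) :
  a = - b -> b = c -> c = - d -> d = e -> e = - f -> f = a -> a = 0.
Proof. by move=> *; lra. Qed.

(** Once the second derivatives of [u] vanish, exactness at the first place of de Rham is used
    twice: the entries of grad u are constants, forming [B], and then the components of u - B x are
    constants. *)
Lemma skew_gradV_rigid (u : V -> V) : Cinf_mx Omega u ->
    (forall x, Omega x -> Defs.skew (gradV u x)) ->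
  exists2 v, rigid v & forall x, Omega x -> u x = v x.
Proof.
move=> Cu skewu; pose D i j := partial j (fun y => u y i 0).
have CD i j : Cinf Omega (D i j) by exact/Cinf_partial/Cu.
have skewD i j x : Omega x -> D i j x = - D j i x.
  move=> Ox; have : (gradV u x)^T = - gradV u x := skewu x Ox.
  by move/matrixP/(_ j i); rewrite !mxE.
have DD0 i j k x : Omega x -> partial k (D i j) x = 0.
  move=> Ox.
  have skewDD i' j' k' : partial k' (D i' j') x = - partial k' (D j' i') x.
    rewrite -(partialN _ (CD _ _) Ox).
    by apply: (eq_on_partial openOmega) => // y; exact: skewD.
  have symDD i' j' k' : partial k' (D i' j') x = partial j' (D i' k') x.
    exact: (partialC deRham _ _ (Cu i' 0) Ox).
  (* The chain alternately swaps the first two and the last two indices; six swaps return to the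
     initial order. *)
  exact: (alternating_eq0 (skewDD i j k) (symDD j i k) (skewDD j k i)
    (symDD k j i) (skewDD k i j) (symDD i k j)).
have /choice [b bP] (ij : 'I_3 * 'I_3) :
    exists c, forall x, Omega x -> D ij.1 ij.2 x = c.
  apply: (grad_eq0 deRham) => // x Ox; apply/colP => k.
  by rewrite !mxE; exact: DD0.
pose B : M := \matrix_(i, j) b (i, j).
have DB i j x : Omega x -> D i j x = B i j.
  by move=> Ox; rewrite mxE; exact: (bP (i, j)).
have skewB : Defs.skew B.
  (* Skew-symmetry of the constant matrix is read off at one point of the nonempty [Omega]. *)
  have [_ _ [x Ox]] := domOmega; apply/matrixP => i j; rewrite mxE [RHS]mxE.
  by rewrite -!(DB _ _ x Ox); exact: skewD.
(* Subtracting B x is written as adding an affine field with zero translation, so that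
   [gradV_affine] applies. *)
have CB := Cinf_mx_affine 0 (- B).
have /choice [a aP] (i : 'I_3) : exists c, forall x, Omega x ->
    u x i 0 + (0 + - B *m x) i 0 = c.
  apply: (grad_eq0 deRham) => [|x Ox]; first exact: CinfD (Cu i 0) (CB i 0).
  apply/colP => j; rewrite [LHS]mxE (partialD _ (Cu i 0) (CB i 0) Ox).
  have /matrixP/(_ i j) := gradV_affine 0 (- B) Ox; rewrite mxE => ->.
  by rewrite [X in X + _](DB i j x Ox) [X in _ + X]mxE [RHS]mxE subrr.
exists (fun x => (\col_i a i) + B *m x); first by exists (\col_i a i), B.
move=> x Ox; apply/colP => i.
have NB : (0 + - B *m x) i 0 = - (B *m x) i 0 by rewrite add0r mulNmx mxE.
by rewrite [RHS]mxE [X in X + _]mxE -(aP i x Ox) NB subrK.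
Qed.

Lemma exact_rigid :
  im_on Omega (@rigid R) (fun v x => (v x, gradV v x)) =
  ker_on Omega (Cinf_VK Omega)
    (fun p x => gradV (fun y => (p y).1) x - (p x).2).
Proof.
apply/seteqP; split=> [p [_ [a [B skewB ->]] pE]|p [[Cu Cq skewq] pE]].
  have pE' x (Ox : Omega x) : p x = (a + B *m x, B).
    by rewrite pE // gradV_affine.
  split; last first.
    move=> x Ox; rewrite (eq_on_gradV openOmega (w := fun y => a + B *m y)) //.
      by rewrite gradV_affine // pE' // subrr.
    by move=> y Oy; rewrite pE'.
  split=> [||x Ox]; last by rewrite pE'.
    apply: (Cinf_mx_eq_on openOmega) (Cinf_mx_affine a B) => x Ox.
    by rewrite pE'.
  apply: (Cinf_mx_eq_on openOmega (F := cst B)) => [x Ox|i k].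
    by rewrite pE'.
  exact: Cinf_cst.
have gE x : Omega x -> gradV (fun y => (p y).1) x = (p x).2.
  by move=> Ox; apply/eqP; rewrite -subr_eq0; apply/eqP; exact: pE.
have [|v rv uv] := skew_gradV_rigid Cu.
  by move=> x Ox; rewrite gE //; exact: skewq.
exists v => // x Ox; rewrite [LHS]surjective_pairing -uv // -gE //.
congr (_, _).
exact: (eq_on_gradV openOmega uv Ox).
Qed.

(** For the hard inclusion, J F = 0 makes Xi^-1 curl F a gradient grad w. Then curl (F + cross_mx w)
    = curl F - Xi (grad w) = 0, so F + cross_mx w = grad u, and the pair (u, cross_mx w) is mapped
    to F. *)
Lemma exact_displacement :
  im_on Omega (Cinf_VK Omega)
    (fun p x => gradV (fun y => (p y).1) x - (p x).2) =
  ker_on Omega (@Cinf_mx _ Omega 3 3) (@J R).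
Proof.
apply/seteqP; split=> [F [p [Cu Cq skewq] FE]|F [CF JF]].
  (* The sign makes [cross_mx (w y)] equal to minus the skew component, so that [F] becomes a sum of
     a gradient and a skew field. *)
  pose w y := - (2^-1 *: axial (p y).2).
  have Cw : Cinf_mx Omega w.
    exact: Cinf_mx_linear (@linear_opp R _ _) (Cinf_mx_half_axial Cq).
  have Cg := Cinf_mx_gradV Cu.
  have CK : Cinf_mx Omega (fun y => cross_mx (w y)).
    exact: Cinf_mx_linear (@linear_cross_mx R) Cw.
  have FE' x : Omega x -> gradV (fun y => (p y).1) x + cross_mx (w x) = F x.
    by move=> Ox; rewrite FE // /w linearN /= -skwE skw_skew //; exact: skewq.
  have CF : Cinf_mx Omega F.
    exact: Cinf_mx_eq_on FE' (Cinf_mxD openOmega Cg CK).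
  split=> // x Ox; rewrite (JE openOmega deRham CF Ox).
  rewrite -[RHS](curlM_Xi_inv_curlM_cross_mx openOmega deRham Cw Ox).
  apply: (eq_on_curlM openOmega _ Ox) => y Oy; congr (Xi_inv _).
  rewrite -(eq_on_curlM openOmega FE' Oy) (curlMD Cg CK Oy).
  by rewrite (curlM_gradV deRham Cu Oy) add0r.
have CXF : Cinf_mx Omega (fun y => Xi_inv (curlM F y)).
  exact: Cinf_mx_linear (@linear_Xi_inv R) (Cinf_mx_curlM openOmega CF).
have [|w Cw wE] := curlM_eq0 deRham CXF.
  by move=> x Ox; rewrite -(JE openOmega deRham CF Ox); exact: JF.
have CK : Cinf_mx Omega (fun y => cross_mx (w y)).
  exact: Cinf_mx_linear (@linear_cross_mx R) Cw.
have [|u Cu uE] := curlM_eq0 deRham (Cinf_mxD openOmega CF CK).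
  move=> x Ox; rewrite (curlMD CF CK Ox) (curlM_cross_mx openOmega Cw Ox).
  by rewrite -wE // Xi_invK subrr.
exists (fun x => (u x, cross_mx (w x))).
  2: by move=> x Ox /=; rewrite -uE // addrK.
by split=> // x _; exact: skew_cross_mx.
Qed.

Lemma axial_eq0_skw (A : M) : axial A = 0 -> skw A = 0.
Proof. by move=> A0; rewrite skwE A0 scaler0 linear0. Qed.

Lemma skw_eq0_axial (A : M) : skw A = 0 -> axial A = 0.
Proof.
move=> /matrixP A0; apply/colP => i; rewrite !mxE.
by have := A0 (i + 2) (i + 1); rewrite !mxE; lra.
Qed.

(** For the hard inclusion, div G = 0 gives G = curl H. The vanishing of axial G = div (Xi H) then
    gives Xi H = curl T, so H = Xi^-1 curl T and G = J T. *)
Lemma exact_stress :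
  im_on Omega (@Cinf_mx _ Omega 3 3) (@J R) =
  ker_on Omega (@Cinf_mx _ Omega 3 3) (fun F x => (divM F x, skw (F x))).
Proof.
apply/seteqP; split=> [G [F CF GE]|G [CG G0]].
  have CcF := Cinf_mx_curlM openOmega CF.
  have CXF : Cinf_mx Omega (fun y => Xi_inv (curlM F y)).
    exact: Cinf_mx_linear (@linear_Xi_inv R) CcF.
  have GE' x : Omega x -> curlM (fun y => Xi_inv (curlM F y)) x = G x.
    by move=> Ox; rewrite (GE x Ox) (JE openOmega deRham CF Ox).
  split; first exact: Cinf_mx_eq_on GE' (Cinf_mx_curlM openOmega CXF).
  move=> x Ox; congr (_, _).
    by rewrite -(eq_on_divM openOmega GE' Ox) (divM_curlM deRham CXF Ox).
  (* The axial part is div (Xi (Xi^-1 curl F)) = div (curl F) = 0. *)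
  apply: axial_eq0_skw; rewrite -GE' // (axial_curlM openOmega CXF Ox).
  rewrite (eq_on_divM openOmega (G := curlM F)) ?(divM_curlM deRham CF) //.
  by move=> y _; rewrite Xi_invK.
have divG x : Omega x -> divM G x = 0 by move=> /G0 [].
have axG x : Omega x -> axial (G x) = 0.
  by move=> /G0 [_ ?]; exact: skw_eq0_axial.
have [H CH HE] := divM_eq0 deRham CG divG.
have CXH := Cinf_mx_linear openOmega (@linear_Xi R) CH.
have [|T CT TE] := divM_eq0 deRham CXH.
  by move=> x Ox; rewrite -(axial_curlM openOmega CH Ox) -HE ?axG.
exists T => // x Ox.
rewrite (HE x Ox) (JE openOmega deRham CT Ox).
apply: (eq_on_curlM openOmega _ Ox) => y Oy.
by rewrite -TE // XiK.
Qed.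

Lemma linear_skw : linear (@skw R).
Proof. by move=> a A B; apply/matrixP => i j; rewrite !mxE; ring. Qed.

(** For surjectivity, a field [G] with the prescribed divergence is corrected by a curl, which
    leaves the divergence unchanged and adjusts the skew part. *)
Lemma exact_load :
  im_on Omega (@Cinf_mx _ Omega 3 3) (fun F x => (divM F x, skw (F x))) =
  Cinf_VK Omega.
Proof.
apply/seteqP; split=> [p [F CF pE]|p [Cv Ck skewk]].
  split=> [||x Ox].
  - apply: (Cinf_mx_eq_on openOmega) (Cinf_mx_divM openOmega CF) => x Ox.
    by rewrite pE.
  - apply: (Cinf_mx_eq_on openOmega) (Cinf_mx_linear openOmega linear_skw CF).
    by move=> x Ox; rewrite pE.
  - by rewrite pE //= skwE; exact: skew_cross_mx.
have [G CG GE] := divM_surj deRham Cv.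
have CNG : Cinf_mx Omega (fun x => - G x).
  exact: (Cinf_mx_linear openOmega (@linear_opp R _ _) CG).
have CkG : Cinf_mx Omega (fun x => axial ((p x).2 + - G x)).
  exact: (Cinf_mx_linear openOmega (@linear_axial R)
    (Cinf_mxD openOmega Ck CNG)).
(* The correction curl (Xi^-1 L) has axial part div L, so div L must be the axial part that [G]
   lacks. *)
have [L CL LE] := divM_surj deRham CkG.
have CXL : Cinf_mx Omega (fun x => Xi_inv (L x)).
  exact: Cinf_mx_linear (@linear_Xi_inv R) CL.
have CcXL := Cinf_mx_curlM openOmega CXL.
exists (fun x => G x + curlM (fun y => Xi_inv (L y)) x).
  exact: (Cinf_mxD openOmega CG CcXL).
move=> x Ox; rewrite [LHS]surjective_pairing; congr (_, _).
  by rewrite (divMD CG CcXL Ox) (divM_curlM deRham CXL Ox) addr0 GE.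
rewrite skwE linearD /= (axial_curlM openOmega CXL Ox).
rewrite (eq_on_divM openOmega (G := L)) ?Ox //.
  2: by move=> y _; rewrite Xi_invK.
by rewrite -LE // -linearD /= addrC subrK -skwE skw_skew //; exact: skewk.
Qed.

End Exactness.

Theorem theorem4p1 (R : realType) (Omega : set 'cV[R]_3) :
  is_domain Omega -> de_rham_exact Omega -> elasticity_exact Omega.
Proof.
move=> domOmega deRham; split.
- exact: exact_rigid.
- exact: exact_displacement.
- exact: exact_stress.
- exact: exact_load.
Qed.
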